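(* For any $z\in\mathbb{C}^+$ there is a unique $(u,v)\in\mathbb{C}^+\times\mathbb{C}^+$ satisfying $$u=-\frac1N\sum_{k=1}^N\frac{\alpha_k}{z+\alpha_ku+\beta_kv},\qquad v=-\frac1N\sum_{k=1}^N\frac{\beta_k}{z+\alpha_ku+\beta_kv}.$$ Moreover, $(u,v)$ is holomorphic in $z$.
   Context: $\mathbb{C}^+$ is the open upper half plane. $N\ge1$ is an integer and $\alpha_1,\dots,\alpha_N,\beta_1,\dots,\beta_N$ are real numbers with $\alpha_k\ge1$, $\beta_k\ge1$ and $\frac1N\sum_{k=1}^N(\alpha_k^2+\beta_k^2)\le M$, where $M>0$ is a constant not depending on $N$. *)

(* Defs.v *)
From Stdlib Require Import Reals.
From Coquelicot Require Import Coquelicot.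

Open Scope C_scope.

Definition upper_half_plane (z : C) : Prop := (0 < Im z)%R.

(* [sum_n_m f 1 N] is f 1 + ... + f N; only the values of [alpha] and [beta] at
   indices 1, ..., N matter.  For z, u, v in the upper half plane and positive
   alpha k, beta k, the denominators have positive imaginary part, so the value
   of Coquelicot's total division at 0 plays no role. *)
Definition self_consistent (N : nat) (alpha beta : nat -> R) (z u v : C) : Prop :=
  u = - (RtoC (1 / INR N) *
         sum_n_m (G := C_AbelianGroup)
           (fun k => RtoC (alpha k) / (z + RtoC (alpha k) * u + RtoC (beta k) * v)) 1 N)
  /\
  v = - (RtoC (1 / INR N) *
         sum_n_m (G := C_AbelianGroup)
           (fun k => RtoC (beta k) / (z + RtoC (alpha k) * u + RtoC (beta k) * v)) 1 N).

Definition is_solution (N : nat) (alpha beta : nat -> R) (z : C) (p : C * C) : Prop :=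
  upper_half_plane (fst p) /\ upper_half_plane (snd p) /\
  self_consistent N alpha beta z (fst p) (snd p).

(* Taking [C_AbsRing] as scalars makes this complex, not real,
   differentiability.  Meant for open [U]. *)
Definition holomorphic_on (U : C -> Prop) (f : C -> C) : Prop :=
  forall z : C, U z -> ex_derive (K := C_AbsRing) (V := C_NormedModule) f z.

(* Main.v *)
Require Import Defs.
From Stdlib Require Import Reals Lra Lia ClassicalEpsilon.
From Coquelicot Require Import Coquelicot.
Local Open Scope R_scope.

(** Write [s k = z + alpha k * u + beta k * v] and [S g s = - avg (g / s)]; the
    system asks that [(u, v)] be a fixed point of [F = (S alpha, S beta)], and
    [F] maps pairs of points of the upper half plane to such pairs.  Everything
    rests on [F] being a strict contraction for the hyperbolic geometry of the
    half plane, measured by [|w - w'| / sqrt (Im w * Im w')].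

    Subtracting two values of [F], at [(z, u, v)] with denominators [s] and at
    [(z', u', v')] with denominators [t], gives the exact linear relation
    [S g s - S g t = K g 1 * (z - z') + K g alpha * (u - u') + K g beta * (v - v')]
    with [K g h = avg (g * h / (s * t))] ([transform_denom_sub]).  Two uses of the
    Cauchy-Schwarz inequality bound each row of the 2 x 2 matrix [K]:
    [|K g alpha| * sqrt (Im u * Im u') + |K g beta| * sqrt (Im v * Im v')
     <= q * sqrt (Im (S g s) * Im (S g t))] ([kernel_row_bound]), as soon as
    [alpha k * Im u + beta k * Im v <= q * Im (s k)] and likewise for [t].  The
    number [alpha k * Im u + beta k * Im v] is just [Im (s k) - Im z]; when
    [Im u] and [Im v] are bounded and [Im z] is bounded below, this allows some
    [q < 1].  Values of [F] are indeed bounded, because [|s k| >= Im z].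

    Existence: the iterates of [F] move by a geometrically decreasing hyperbolic,
    hence Euclidean, amount, so they converge; the limit lies a priori only in the
    closed half plane, but there [|s k| >= Im z] still holds, so [F] is continuous
    and its fixed point falls into the open half plane ([solution_exists]).

    For two solutions the row bound says that [K], rescaled by the two positive
    weights, has row sums at most [q], whence [|det (1 - K)| >= (1 - q) ^ 2].
    Cramer's rule turns the linear relation into
    [det (1 - K) * (u - u') = (z - z') * numerator] ([solution_pair]).  With
    [z = z'] this is uniqueness; with a bound on the numerator it is local
    Lipschitz continuity of the solution in [z]; and then
    [(u - u') / (z - z') = numerator / det (1 - K)] has a limit as [z' -> z], since
    the right-hand side is built continuously from [z, u, v]
    ([holomorphic_solution]). *)

(** * Averages over the indices 1, ..., N *)

Definition Ravg (N : nat) (f : nat -> R) : R := 1 / INR N * sum_n_m f 1 N.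

Definition Cavg (N : nat) (f : nat -> C) : C :=
  (RtoC (1 / INR N) * sum_n_m (G := C_AbelianGroup) f 1 N)%C.

Definition positive_on (N : nat) (g : nat -> R) : Prop :=
  forall k : nat, (1 <= k <= N)%nat -> 0 < g k.

Lemma inv_INR_pos (N : nat) : (1 <= N)%nat -> 0 < 1 / INR N.
Proof.
  intros HN. apply Rdiv_lt_0_compat; [lra | apply lt_0_INR; lia].
Qed.

Lemma inv_INR_nonneg (N : nat) : (1 <= N)%nat -> 0 <= 1 / INR N.
Proof. intros HN. apply Rlt_le, inv_INR_pos, HN. Qed.

(** Relates two sums over the same indices in possibly different groups, as for a
    complex sum and the real sum of its imaginary parts. *)
Lemma sum_n_m_pair_ind (G H : AbelianMonoid) (P : G -> H -> Prop)
    (f : nat -> G) (g : nat -> H) (N : nat) :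
  P zero zero ->
  (forall x y x' y', P x y -> P x' y' -> P (plus x x') (plus y y')) ->
  (forall k : nat, (1 <= k <= N)%nat -> P (f k) (g k)) ->
  P (sum_n_m f 1 N) (sum_n_m g 1 N).
Proof.
  intros H0 Hplus. induction N as [|N IH]; intros Hfg.
  - rewrite !sum_n_m_zero by lia. exact H0.
  - rewrite !sum_n_Sm by lia. apply Hplus.
    + apply IH. intros k Hk. apply Hfg. lia.
    + apply Hfg. lia.
Qed.

Lemma Ravg_le (N : nat) (f g : nat -> R) : (1 <= N)%nat ->
  (forall k : nat, (1 <= k <= N)%nat -> f k <= g k) -> Ravg N f <= Ravg N g.
Proof.
  intros HN Hfg. apply Rmult_le_compat_l; [apply inv_INR_nonneg, HN |].
  apply (sum_n_m_pair_ind _ _ (fun x y : R => x <= y)); [apply Rle_refl | | exact Hfg].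
  intros; apply Rplus_le_compat; assumption.
Qed.

Lemma Ravg_scal (N : nat) (c : R) (f : nat -> R) :
  Ravg N (fun k => c * f k) = c * Ravg N f.
Proof.
  transitivity (1 / INR N * (c * sum_n_m f 1 N)); [| unfold Ravg; ring].
  exact (f_equal (Rmult (1 / INR N)) (sum_n_m_mult_l (K := R_Ring) c f 1 N)).
Qed.

Lemma Ravg_plus (N : nat) (f g : nat -> R) :
  Ravg N (fun k => f k + g k) = Ravg N f + Ravg N g.
Proof.
  transitivity (1 / INR N * (sum_n_m f 1 N + sum_n_m g 1 N)); [| unfold Ravg; ring].
  exact (f_equal (Rmult (1 / INR N)) (sum_n_m_plus f g 1 N)).
Qed.

Lemma Ravg_nonneg (N : nat) (f : nat -> R) : (1 <= N)%nat ->
  (forall k : nat, (1 <= k <= N)%nat -> 0 <= f k) -> 0 <= Ravg N f.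
Proof.
  intros HN Hf.
  apply Rle_trans with (Ravg N (fun _ => 0 * 0)).
  - rewrite Ravg_scal. lra.
  - apply Ravg_le; [exact HN |]. intros k Hk. specialize (Hf k Hk). lra.
Qed.

Lemma Ravg_pos (N : nat) (f : nat -> R) : (1 <= N)%nat ->
  positive_on N f -> 0 < Ravg N f.
Proof.
  intros HN Hf. apply Rmult_lt_0_compat; [apply inv_INR_pos, HN |].
  destruct N as [|N]; [lia |].
  rewrite sum_n_Sm by lia. apply Rplus_le_lt_0_compat; [| apply Hf; lia].
  apply (sum_n_m_pair_ind R_AbelianMonoid _ (fun x _ : R => 0 <= x) f f); [apply Rle_refl | |].
  - intros; apply Rplus_le_le_0_compat; assumption.
  - intros k Hk. apply Rlt_le, Hf. lia.
Qed.

Lemma Im_Cavg (N : nat) (f : nat -> C) : Im (Cavg N f) = Ravg N (fun k => Im (f k)).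
Proof.
  unfold Cavg, Ravg. rewrite im_scal_l. f_equal.
  apply (sum_n_m_pair_ind C_AbelianGroup R_AbelianMonoid (fun x y => Im x = y)); try reflexivity.
  intros x y x' y' <- <-. apply im_plus.
Qed.

Lemma Cmod_Cavg_le (N : nat) (f : nat -> C) : (1 <= N)%nat ->
  Cmod (Cavg N f) <= Ravg N (fun k => Cmod (f k)).
Proof.
  intros HN. unfold Cavg, Ravg.
  rewrite Cmod_mult, Cmod_R, Rabs_pos_eq by apply inv_INR_nonneg, HN.
  apply Rmult_le_compat_l; [apply inv_INR_nonneg, HN |].
  apply (norm_sum_n_m (K := C_AbsRing) (V := C_NormedModule)).
Qed.

Lemma Cavg_ext (N : nat) (f g : nat -> C) :
  (forall k : nat, (1 <= k <= N)%nat -> f k = g k) -> Cavg N f = Cavg N g.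
Proof.
  intros Hfg. unfold Cavg. f_equal. apply sum_n_m_ext_loc, Hfg.
Qed.

Lemma Cavg_scal (N : nat) (c : C) (f : nat -> C) :
  Cavg N (fun k => (c * f k)%C) = (c * Cavg N f)%C.
Proof.
  transitivity (RtoC (1 / INR N) * (c * sum_n_m (G := C_AbelianGroup) f 1 N))%C;
    [| unfold Cavg; ring].
  exact (f_equal (Cmult (RtoC (1 / INR N))) (sum_n_m_mult_l (K := C_Ring) c f 1 N)).
Qed.

Lemma Cavg_plus (N : nat) (f g : nat -> C) :
  Cavg N (fun k => (f k + g k)%C) = (Cavg N f + Cavg N g)%C.
Proof.
  transitivity (RtoC (1 / INR N) * (sum_n_m (G := C_AbelianGroup) f 1 N
                  + sum_n_m (G := C_AbelianGroup) g 1 N))%C; [| unfold Cavg; ring].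
  exact (f_equal (Cmult (RtoC (1 / INR N)))
           (sum_n_m_plus (G := C_AbelianGroup) f g 1 N)).
Qed.

(** The Cauchy-Schwarz inequality in the plane, for the vectors
    [(sqrt a, sqrt c)] and [(sqrt b, sqrt d)]. *)
Lemma sqrt_cauchy (a b c d : R) : 0 <= a -> 0 <= b -> 0 <= c -> 0 <= d ->
  sqrt a * sqrt b + sqrt c * sqrt d <= sqrt (a + c) * sqrt (b + d).
Proof.
  intros Ha Hb Hc Hd.
  apply Rsqr_incr_0_var; [| apply Rmult_le_pos; apply sqrt_pos].
  rewrite Rsqr_mult, !Rsqr_sqrt by lra.
  rewrite <- (Rsqr_sqrt a Ha) at 2. rewrite <- (Rsqr_sqrt b Hb) at 2.
  rewrite <- (Rsqr_sqrt c Hc) at 2. rewrite <- (Rsqr_sqrt d Hd) at 2.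
  generalize (sqrt a), (sqrt b), (sqrt c), (sqrt d). intros p q r s. unfold Rsqr.
  pose proof (Rle_0_sqr (p * s - r * q)) as H. unfold Rsqr in H. lra.
Qed.

(** Cauchy-Schwarz for averages.  Asking only that [f] be dominated by the product
    of the square roots lets the summands be estimated in the same stroke. *)
Lemma Ravg_cauchy (N : nat) (f x y : nat -> R) : (1 <= N)%nat ->
  (forall k : nat, (1 <= k <= N)%nat ->
     0 <= x k /\ 0 <= y k /\ f k <= sqrt (x k) * sqrt (y k)) ->
  Ravg N f <= sqrt (Ravg N x) * sqrt (Ravg N y).
Proof.
  intros HN Hk.
  assert (Hsum : 0 <= sum_n_m x 1 N /\ 0 <= sum_n_m y 1 N /\
            sum_n_m f 1 N <= sqrt (sum_n_m x 1 N) * sqrt (sum_n_m y 1 N)).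
  { clear HN. induction N as [|N IH].
    - rewrite !sum_n_m_zero by lia. change zero with 0. rewrite sqrt_0. lra.
    - rewrite !sum_n_Sm by lia.
      destruct IH as (Hx & Hy & Hf); [intros k Hle; apply Hk; lia |].
      destruct (Hk (S N)) as (Hx' & Hy' & Hf'); [lia |].
      pose proof (sqrt_cauchy _ _ _ _ Hx Hy Hx' Hy') as Hc.
      unfold plus; simpl.
      repeat split; lra. }
  destruct Hsum as (Hx & Hy & Hf).
  pose proof (inv_INR_nonneg N HN) as Hc.
  unfold Ravg. rewrite !sqrt_mult by assumption.
  rewrite <- (sqrt_sqrt (1 / INR N) Hc) at 1.
  pose proof (sqrt_pos (1 / INR N)). nra.
Qed.

(** * The transform and its difference kernel *)

Definition transform (N : nat) (g : nat -> R) (s : nat -> C) : C :=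
  (- Cavg N (fun k => RtoC (g k) / s k))%C.

(** The difference quotient of [transform N g] at the denominators [s] and [t], in
    the direction in which the [k]-th denominator moves by [h k]. *)
Definition kernel (N : nat) (g h : nat -> R) (s t : nat -> C) : C :=
  Cavg N (fun k => RtoC (g k * h k) / (s k * t k))%C.

Definition in_strip (N : nat) (eta : R) (s : nat -> C) : Prop :=
  forall k : nat, (1 <= k <= N)%nat -> eta <= Im (s k).

Lemma im_le_Cmod (z : C) : Im z <= Cmod z.
Proof.
  eapply Rle_trans; [apply Rle_abs |].
  eapply Rle_trans; [apply Rmax_r | apply Rmax_Cmod].
Qed.

Lemma Im_pos_neq_0 (z : C) : 0 < Im z -> z <> 0%C.
Proof. intros Hz ->. simpl in Hz. lra. Qed.

Lemma Im_div (r : R) (z : C) : z <> 0%C -> Im (RtoC r / z) = - (r * Im z / Cmod z ^ 2).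
Proof.
  intros Hz. rewrite Cmod2_alt.
  unfold Cdiv. rewrite im_scal_l. unfold Cinv, Im, Re; simpl. unfold Rdiv. ring.
Qed.

Lemma Im_transform (N : nat) (g : nat -> R) (s : nat -> C) : (1 <= N)%nat ->
  positive_on N (fun k => Im (s k)) ->
  Im (transform N g s) = Ravg N (fun k => g k * Im (s k) / Cmod (s k) ^ 2).
Proof.
  intros HN Hs. unfold transform. rewrite im_opp, Im_Cavg.
  rewrite <- (Rmult_1_l (Ravg N _)), <- Ropp_mult_distr_l_reverse.
  rewrite <- Ravg_scal. apply Rle_antisym; apply Ravg_le; auto; intros k Hk;
  rewrite Im_div by (apply Im_pos_neq_0, Hs, Hk); lra.
Qed.

Lemma Im_transform_pos (N : nat) (g : nat -> R) (s : nat -> C) : (1 <= N)%nat ->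
  positive_on N g -> positive_on N (fun k => Im (s k)) -> 0 < Im (transform N g s).
Proof.
  intros HN Hg Hs. rewrite Im_transform by assumption.
  apply Ravg_pos; [exact HN |]. intros k Hk.
  specialize (Hg k Hk); specialize (Hs k Hk).
  apply Rdiv_lt_0_compat; [nra |]. apply pow_lt, Cmod_gt_0, Im_pos_neq_0, Hs.
Qed.

Lemma Im_transform_le (N : nat) (g : nat -> R) (s : nat -> C) (eta : R) : (1 <= N)%nat ->
  positive_on N g -> 0 < eta -> in_strip N eta s ->
  Im (transform N g s) <= / eta * Ravg N g.
Proof.
  intros HN Hg Heta Hs. eapply Rle_trans; [apply im_le_Cmod |].
  unfold transform. rewrite Cmod_opp.
  eapply Rle_trans; [apply Cmod_Cavg_le, HN |].
  rewrite <- Ravg_scal. apply Ravg_le; [exact HN |]. intros k Hk.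
  specialize (Hg k Hk); specialize (Hs k Hk). pose proof (im_le_Cmod (s k)).
  rewrite Cmod_div by (apply Im_pos_neq_0; lra).
  rewrite Cmod_R, Rabs_pos_eq by lra. rewrite Rmult_comm.
  apply Rmult_le_compat_l; [lra |]. apply Rinv_le_contravar; lra.
Qed.

Lemma kernel_bounded (N : nat) (g h : nat -> R) (eta : R) : (1 <= N)%nat ->
  positive_on N g -> positive_on N h -> 0 < eta ->
  exists L : R, 0 <= L /\ forall s t : nat -> C,
    in_strip N eta s -> in_strip N eta t -> Cmod (kernel N g h s t) <= L.
Proof.
  intros HN Hg Hh Heta.
  exists (/ (eta * eta) * Ravg N (fun k => g k * h k)). split.
  { apply Rmult_le_pos; [left; apply Rinv_0_lt_compat; nra |].
    apply Ravg_nonneg; [exact HN |]. intros k Hk. specialize (Hg k Hk); specialize (Hh k Hk). nra. }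
  intros s t Hs Ht. unfold kernel.
  eapply Rle_trans; [apply Cmod_Cavg_le, HN |].
  rewrite <- Ravg_scal. apply Ravg_le; [exact HN |]. intros k Hk.
  specialize (Hg k Hk); specialize (Hh k Hk); specialize (Hs k Hk); specialize (Ht k Hk).
  pose proof (im_le_Cmod (s k)); pose proof (im_le_Cmod (t k)).
  rewrite Cmod_div, Cmod_mult by (apply Cmult_neq_0; apply Im_pos_neq_0; lra).
  rewrite Cmod_R, Rabs_pos_eq by nra. rewrite (Rmult_comm (/ _)).
  apply Rmult_le_compat_l; [nra |]. apply Rinv_le_contravar; nra.
Qed.

(** Each summand obeys [g / t - g / s = g * (s - t) / (s * t)]: the difference is
    exactly linear in the displacement, with no remainder term. *)
Lemma transform_sub (N : nat) (g a b : nat -> R) (s t : nat -> C) (dz du dv : C) :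
  (forall k : nat, (1 <= k <= N)%nat -> s k <> 0%C /\ t k <> 0%C /\
     (s k - t k = dz + RtoC (a k) * du + RtoC (b k) * dv)%C) ->
  (transform N g s - transform N g t =
   kernel N g (fun _ => 1%R) s t * dz + kernel N g a s t * du + kernel N g b s t * dv)%C.
Proof.
  intros Hst. unfold transform, kernel.
  rewrite (Cmult_comm _ dz), (Cmult_comm _ du), (Cmult_comm _ dv).
  rewrite <- !Cavg_scal, <- !Cavg_plus.
  transitivity (Cavg N (fun k => RtoC (g k) / t k + (- (1)) * (RtoC (g k) / s k)))%C.
  { rewrite Cavg_plus, Cavg_scal. ring. }
  apply Cavg_ext. intros k Hk. destruct (Hst k Hk) as (Hs & Ht & Hd).
  rewrite !RtoC_mult.
  transitivity (RtoC (g k) * (s k - t k) / (s k * t k))%C; [field; auto |].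
  rewrite Hd. field; auto.
Qed.

(** [Cmod (w - w') / weight w w'] is twice the hyperbolic sine of half the hyperbolic
    distance from [w] to [w'] in the upper half plane. *)
Definition weight (w w' : C) : R := sqrt (Im w) * sqrt (Im w').

Lemma weight_pos (w w' : C) : 0 < Im w -> 0 < Im w' -> 0 < weight w w'.
Proof. intros Hw Hw'. apply Rmult_lt_0_compat; apply sqrt_lt_R0; assumption. Qed.

Lemma weight_le (w w' : C) (W : R) : 0 <= W -> Im w <= W -> Im w' <= W -> weight w w' <= W.
Proof.
  intros HW Hw Hw'. rewrite <- (sqrt_sqrt W HW).
  apply Rmult_le_compat; try apply sqrt_pos; apply sqrt_le_1_alt; assumption.
Qed.

(** The heart of the contraction.  Cauchy-Schwarz in the plane bounds
    [a k * weight u x + b k * weight v y] by the geometric mean of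
    [a k * Im u + b k * Im v] and [a k * Im x + b k * Im y], hence by
    [q * sqrt (Im (s k)) * sqrt (Im (t k))]; Cauchy-Schwarz over [k] then rebuilds
    the imaginary parts of the transforms, which are the averages of
    [g * Im s / |s| ^ 2] and [g * Im t / |t| ^ 2]. *)
Lemma kernel_row_bound (N : nat) (g a b : nat -> R) (s t : nat -> C)
    (u v x y : C) (q : R) : (1 <= N)%nat ->
  positive_on N g -> positive_on N a -> positive_on N b ->
  0 < Im u -> 0 < Im v -> 0 < Im x -> 0 < Im y -> 0 <= q ->
  positive_on N (fun k => Im (s k)) -> positive_on N (fun k => Im (t k)) ->
  (forall k : nat, (1 <= k <= N)%nat -> a k * Im u + b k * Im v <= q * Im (s k)) ->
  (forall k : nat, (1 <= k <= N)%nat -> a k * Im x + b k * Im y <= q * Im (t k)) ->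
  Cmod (kernel N g a s t) * weight u x + Cmod (kernel N g b s t) * weight v y
  <= q * weight (transform N g s) (transform N g t).
Proof.
  intros HN Hg Ha Hb Hy1 Hy2 Hx1 Hx2 Hq Hs Ht Hqs Hqt. unfold weight.
  generalize dependent (Im u); generalize dependent (Im v);
  generalize dependent (Im x); generalize dependent (Im y).
  intros x2 Hx2 x1 Hx1 Hqt y2 Hy2 y1 Hy1 Hqs.
  assert (Hentry : forall h : nat -> R, positive_on N h ->
    Cmod (kernel N g h s t) <= Ravg N (fun k => g k * h k / (Cmod (s k) * Cmod (t k)))).
  { intros h Hh. eapply Rle_trans; [apply Cmod_Cavg_le, HN |].
    apply Ravg_le; [exact HN |]. intros k Hk.
    specialize (Hg k Hk); specialize (Hh k Hk); specialize (Hs k Hk); specialize (Ht k Hk).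
    rewrite Cmod_div, Cmod_mult by (apply Cmult_neq_0; apply Im_pos_neq_0; assumption).
    rewrite Cmod_R, Rabs_pos_eq by nra. apply Rle_refl. }
  assert (HY1 : 0 <= sqrt y1 * sqrt x1) by (apply Rmult_le_pos; apply sqrt_pos).
  assert (HY2 : 0 <= sqrt y2 * sqrt x2) by (apply Rmult_le_pos; apply sqrt_pos).
  eapply Rle_trans.
  { apply Rplus_le_compat; (apply Rmult_le_compat_r; [assumption | apply Hentry; assumption]). }
  rewrite (Rmult_comm _ (sqrt y1 * _)), (Rmult_comm _ (sqrt y2 * _)).
  rewrite <- !Ravg_scal, <- Ravg_plus, !Im_transform by assumption.
  (* The factor q is split evenly between the two square roots. *)
  rewrite <- (sqrt_sqrt q Hq), Rmult_assoc.
  replace (sqrt q * (sqrt q * _)) with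
    (sqrt (q * Ravg N (fun k => g k * Im (s k) / Cmod (s k) ^ 2)) *
     sqrt (q * Ravg N (fun k => g k * Im (t k) / Cmod (t k) ^ 2))).
  2: { rewrite !sqrt_mult_alt by assumption. ring. }
  rewrite <- !Ravg_scal. apply Ravg_cauchy; [exact HN |]. intros k Hk.
  specialize (Hg k Hk); specialize (Ha k Hk); specialize (Hb k Hk);
  specialize (Hs k Hk); specialize (Ht k Hk); specialize (Hqs k Hk); specialize (Hqt k Hk).
  assert (Hms : 0 < Cmod (s k)) by (apply Cmod_gt_0, Im_pos_neq_0, Hs).
  assert (Hmt : 0 < Cmod (t k)) by (apply Cmod_gt_0, Im_pos_neq_0, Ht).
  generalize dependent (Cmod (s k)); generalize dependent (Cmod (t k)).
  intros m Hm n Hn.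
  assert (Hsq : forall r p : R, 0 <= r -> 0 < p ->
            q * (g k * r / p ^ 2) = g k * (q * r) / p ^ 2 /\
            sqrt (g k * (q * r) / p ^ 2) = sqrt (g k) * sqrt (q * r) / p /\
            0 <= g k * (q * r) / p ^ 2).
  { intros r p Hr Hp. repeat split.
    - field. lra.
    - rewrite sqrt_div_alt by (apply pow_lt, Hp).
      rewrite sqrt_pow2 by lra. rewrite sqrt_mult_alt by lra. reflexivity.
    - apply Rle_mult_inv_pos; [| apply pow_lt, Hp]. apply Rmult_le_pos; [lra |].
      apply Rmult_le_pos; lra. }
  destruct (Hsq (Im (s k)) n) as (-> & -> & Hs'); [lra | lra |].
  destruct (Hsq (Im (t k)) m) as (-> & -> & Ht'); [lra | lra |].
  split; [exact Hs' | split; [exact Ht' |]].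
  pose proof (sqrt_cauchy (a k * y1) (a k * x1) (b k * y2) (b k * x2)) as Hc.
  rewrite !(sqrt_mult_alt (a k)), !(sqrt_mult_alt (b k)) in Hc by lra.
  assert (Hc' : a k * (sqrt y1 * sqrt x1) + b k * (sqrt y2 * sqrt x2)
                <= sqrt (q * Im (s k)) * sqrt (q * Im (t k))).
  { eapply Rle_trans.
    - eapply Rle_trans; [| apply Hc; nra].
      rewrite <- (sqrt_sqrt (a k)) at 1 by lra. rewrite <- (sqrt_sqrt (b k)) at 1 by lra.
      right. ring.
    - apply Rmult_le_compat; try apply sqrt_pos; apply sqrt_le_1_alt; assumption. }
  replace (sqrt (g k) * sqrt (q * Im (s k)) / n * (sqrt (g k) * sqrt (q * Im (t k)) / m))
    with (g k / (n * m) * (sqrt (q * Im (s k)) * sqrt (q * Im (t k)))).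
  2: { rewrite <- (sqrt_sqrt (g k)) at 1 by lra. field. lra. }
  replace (sqrt y1 * sqrt x1 * (g k * a k / (n * m)) + sqrt y2 * sqrt x2 * (g k * b k / (n * m)))
    with (g k / (n * m) * (a k * (sqrt y1 * sqrt x1) + b k * (sqrt y2 * sqrt x2))) by (field; lra).
  apply Rmult_le_compat_l; [| exact Hc'].
  apply Rle_mult_inv_pos; [lra |]. apply Rmult_lt_0_compat; assumption.
Qed.
(** * The denominators *)

Definition denom (a b : nat -> R) (z u v : C) (k : nat) : C :=
  (z + RtoC (a k) * u + RtoC (b k) * v)%C.

Lemma Im_denom (a b : nat -> R) (z u v : C) (k : nat) :
  Im (denom a b z u v k) = Im z + (a k * Im u + b k * Im v).
Proof. unfold denom. rewrite !im_plus, !im_scal_l. ring. Qed.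

Lemma denom_strip (N : nat) (a b : nat -> R) (z u v : C) (eta : R) :
  positive_on N a -> positive_on N b -> eta <= Im z -> 0 <= Im u -> 0 <= Im v ->
  in_strip N eta (denom a b z u v).
Proof.
  intros Ha Hb Hz Hu Hv k Hk. rewrite Im_denom.
  specialize (Ha k Hk); specialize (Hb k Hk). nra.
Qed.

Lemma in_strip_pos (N : nat) (eta : R) (s : nat -> C) :
  0 < eta -> in_strip N eta s -> positive_on N (fun k => Im (s k)).
Proof. intros Heta Hs k Hk. apply Rlt_le_trans with eta; auto. Qed.

Lemma self_consistent_transform (N : nat) (a b : nat -> R) (z u v : C) :
  self_consistent N a b z u v <->
  u = transform N a (denom a b z u v) /\ v = transform N b (denom a b z u v).
Proof. reflexivity. Qed.

Lemma bounded_above_on (N : nat) (f : nat -> R) :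
  exists T : R, 0 <= T /\ forall k : nat, (1 <= k <= N)%nat -> f k <= T.
Proof.
  induction N as [|N (T & HT & Hf)].
  - exists 0. split; [lra | intros k Hk; lia].
  - exists (Rmax T (f (S N))). pose proof (Rmax_l T (f (S N))). pose proof (Rmax_r T (f (S N))).
    split; [lra |]. intros k Hk.
    destruct (Nat.eq_dec k (S N)) as [-> | Hne]; [assumption |].
    specialize (Hf k ltac:(lia)). lra.
Qed.

(** With [w = a k * Im u + b k * Im v] the claim reads [w <= q * (Im z + w)].  The
    ratio [w / (eta + w)] increases with [w], so its value at an upper bound [T * W]
    of [w] serves as [q]. *)
Lemma contraction_factor (N : nat) (a b : nat -> R) (eta W : R) :
  positive_on N a -> positive_on N b -> 0 < eta -> 0 <= W ->
  exists q : R, 0 <= q < 1 /\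
    forall z u v : C, eta <= Im z -> 0 <= Im u <= W -> 0 <= Im v <= W ->
    forall k : nat, (1 <= k <= N)%nat ->
      a k * Im u + b k * Im v <= q * Im (denom a b z u v k).
Proof.
  intros Ha Hb Heta HW.
  destruct (bounded_above_on N (fun k => a k + b k)) as (T & HT & Hab).
  assert (Hc : 0 <= T * W) by nra.
  exists (T * W / (eta + T * W)). split.
  { split; [apply Rle_mult_inv_pos; lra |].
    apply Rmult_lt_reg_r with (eta + T * W); [lra |]. field_simplify; lra. }
  intros z u v Hz Hu Hv k Hk. rewrite Im_denom.
  specialize (Ha k Hk); specialize (Hb k Hk); specialize (Hab k Hk); simpl in Hab.
  set (w := a k * Im u + b k * Im v).
  assert (Hw : 0 <= w <= T * W) by (unfold w; split; nra).
  apply Rmult_le_reg_r with (eta + T * W); [lra |].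
  replace (T * W / (eta + T * W) * (Im z + w) * (eta + T * W))
    with (T * W * (Im z + w)) by (field; lra).
  nra.
Qed.

Lemma transform_denom_sub (N : nat) (g a b : nat -> R) (z z' u v x y : C) :
  let s := denom a b z u v in let t := denom a b z' x y in
  positive_on N (fun k => Im (s k)) -> positive_on N (fun k => Im (t k)) ->
  (transform N g s - transform N g t =
   kernel N g (fun _ => 1%R) s t * (z - z') + kernel N g a s t * (u - x)
   + kernel N g b s t * (v - y))%C.
Proof.
  intros s t Hs Ht. apply transform_sub. intros k Hk.
  repeat split; [apply Im_pos_neq_0, Hs, Hk | apply Im_pos_neq_0, Ht, Hk |].
  unfold s, t, denom. ring.
Qed.

(** * Existence *)

Definition converges_to (p : nat -> C) (l : C) : Prop :=
  forall eps : R, 0 < eps ->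
    exists n0 : nat, forall n : nat, (n0 <= n)%nat -> Cmod (p n - l) < eps.

Lemma geometric_steps_converge (p : nat -> C) (c q : R) : 0 <= q < 1 ->
  (forall n : nat, Cmod (p (S n) - p n) <= c * q ^ n) ->
  exists l : C, converges_to p l.
Proof.
  intros Hq Hp.
  destruct (ex_series_le (K := C_AbsRing) (V := C_CompleteNormedModule)
              (fun n => (p (S n) - p n)%C) (fun n => c * q ^ n)) as (l & Hl).
  - exact Hp.
  - apply (ex_series_scal_l (K := R_AbsRing) (V := R_NormedModule) c (fun n => q ^ n)), ex_series_geom. rewrite Rabs_pos_eq; lra.
  - assert (Hsum : forall n : nat,
      sum_n (G := C_AbelianGroup) (fun k => (p (S k) - p k)%C) n = (p (S n) - p O)%C).
    { induction n as [|n IH]; [apply sum_O |].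
      rewrite sum_Sn, IH. change plus with Cplus. simpl. ring. }
    exists (l + p O)%C. intros eps Heps.
    destruct (proj1 (filterlim_locally_ball_norm (K := C_AbsRing) (U := C_NormedModule) _ _)
                Hl (mkposreal eps Heps)) as (n0 & Hn0).
    exists (S n0). intros [|n] Hn; [lia |].
    specialize (Hn0 n ltac:(lia)). unfold ball_norm in Hn0.
    change (Cmod (sum_n (G := C_AbelianGroup) (fun k => (p (S k) - p k)%C) n - l) < eps) in Hn0.
    rewrite Hsum in Hn0. replace (p (S n) - (l + p O))%C with (p (S n) - p O - l)%C by ring.
    exact Hn0.
Qed.

Lemma Im_limit_nonneg (p : nat -> C) (l : C) :
  (forall n : nat, 0 < Im (p n)) -> converges_to p l -> 0 <= Im l.
Proof.
  intros Hpos Hl. apply Rnot_lt_le. intros Hneg.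
  destruct (Hl (- Im l)) as (n0 & Hn0); [lra |].
  specialize (Hn0 n0 (Nat.le_refl _)). specialize (Hpos n0).
  pose proof (im_le_Cmod (p n0 - l)) as Him. unfold Cminus in Him.
  rewrite im_plus, im_opp in Him. unfold Cminus in Hn0. lra.
Qed.

Lemma transform_contracts (N : nat) (g a b : nat -> R) (z u v x y : C) (q d : R) :
  let s := denom a b z u v in let t := denom a b z x y in
  (1 <= N)%nat -> positive_on N g -> positive_on N a -> positive_on N b ->
  0 < Im u -> 0 < Im v -> 0 < Im x -> 0 < Im y -> 0 <= q -> 0 <= d ->
  positive_on N (fun k => Im (s k)) -> positive_on N (fun k => Im (t k)) ->
  (forall k : nat, (1 <= k <= N)%nat -> a k * Im u + b k * Im v <= q * Im (s k)) ->
  (forall k : nat, (1 <= k <= N)%nat -> a k * Im x + b k * Im y <= q * Im (t k)) ->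
  Cmod (u - x) <= d * weight u x -> Cmod (v - y) <= d * weight v y ->
  Cmod (transform N g s - transform N g t) <=
  d * q * weight (transform N g s) (transform N g t).
Proof.
  intros s t HN Hg Ha Hb Hu Hv Hx Hy Hq Hd Ps Pt Hqs Hqt Hux Hvy.
  pose proof (transform_denom_sub N g a b z z u v x y Ps Pt) as Hsub. fold s t in Hsub.
  rewrite Hsub.
  replace (kernel N g (fun _ => 1%R) s t * (z - z) + kernel N g a s t * (u - x)
           + kernel N g b s t * (v - y))%C
    with (kernel N g a s t * (u - x) + kernel N g b s t * (v - y))%C by ring.
  eapply Rle_trans; [apply Cmod_triangle |]. rewrite !Cmod_mult.
  pose proof (kernel_row_bound N g a b s t u v x y q HN Hg Ha Hb Hu Hv Hx Hy Hq Ps Pt Hqs Hqt)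
    as Hrow.
  apply (Rmult_le_compat_l _ _ _ Hd) in Hrow.
  pose proof (Rmult_le_compat_l _ _ _ (Cmod_ge_0 (kernel N g a s t)) Hux).
  pose proof (Rmult_le_compat_l _ _ _ (Cmod_ge_0 (kernel N g b s t)) Hvy).
  lra.
Qed.

(** A Euclidean estimate up to the real axis, where the hyperbolic one says nothing:
    needed for a limit of iterates that might lie on the boundary. *)
Lemma transform_lipschitz (N : nat) (g a b : nat -> R) (z : C) :
  (1 <= N)%nat -> positive_on N g -> positive_on N a -> positive_on N b -> 0 < Im z ->
  exists c : R, 0 <= c /\ forall u v x y : C,
    0 <= Im u -> 0 <= Im v -> 0 <= Im x -> 0 <= Im y ->
    Cmod (transform N g (denom a b z u v) - transform N g (denom a b z x y))
    <= c * (Cmod (u - x) + Cmod (v - y)).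
Proof.
  intros HN Hg Ha Hb Hz.
  destruct (kernel_bounded N g a (Im z) HN Hg Ha Hz) as (La & HLa & HKa).
  destruct (kernel_bounded N g b (Im z) HN Hg Hb Hz) as (Lb & HLb & HKb).
  exists (La + Lb). split; [lra |]. intros u v x y Hu Hv Hx Hy.
  pose proof (denom_strip N a b z u v (Im z) Ha Hb (Rle_refl _) Hu Hv) as Hs.
  pose proof (denom_strip N a b z x y (Im z) Ha Hb (Rle_refl _) Hx Hy) as Ht.
  specialize (HKa _ _ Hs Ht). specialize (HKb _ _ Hs Ht).
  rewrite (transform_denom_sub N g a b z z u v x y)
    by (apply (in_strip_pos _ (Im z)); assumption).
  set (K1 := kernel N g a _ _) in *. set (K2 := kernel N g b _ _) in *.
  replace (z - z)%C with (RtoC 0) by ring. rewrite Cmult_0_r, Cplus_0_l.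
  eapply Rle_trans; [apply Cmod_triangle |]. rewrite !Cmod_mult.
  pose proof (Cmod_ge_0 (u - x)); pose proof (Cmod_ge_0 (v - y)).
  pose proof (Rmult_le_compat_r _ _ _ H HKa). pose proof (Rmult_le_compat_r _ _ _ H0 HKb).
  pose proof (Rmult_le_pos _ _ HLa H0). pose proof (Rmult_le_pos _ _ HLb H). lra.
Qed.

Lemma transform_limit (N : nat) (g a b : nat -> R) (z x y l : C) (u v w : nat -> C) :
  (1 <= N)%nat -> positive_on N g -> positive_on N a -> positive_on N b -> 0 < Im z ->
  (forall n : nat, 0 < Im (u n)) -> (forall n : nat, 0 < Im (v n)) ->
  converges_to u x -> converges_to v y -> converges_to w l ->
  (forall n : nat, w (S n) = transform N g (denom a b z (u n) (v n))) ->
  l = transform N g (denom a b z x y).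
Proof.
  intros HN Hg Ha Hb Hz Hu Hv Hx Hy Hl Hrec.
  destruct (transform_lipschitz N g a b z HN Hg Ha Hb Hz) as (c & Hc & Hlip).
  pose proof (Im_limit_nonneg u x Hu Hx) as Hx0. pose proof (Im_limit_nonneg v y Hv Hy) as Hy0.
  set (t := transform N g (denom a b z x y)) in *.
  apply Ceq_minus, Cmod_eq_0, Rle_antisym; [| apply Cmod_ge_0].
  apply Rnot_lt_le. intros Hpos.
  set (e := Cmod (l - t)) in *. set (d := e / (2 * (1 + 2 * c))).
  assert (Hd : 0 < d) by (apply Rdiv_lt_0_compat; lra).
  destruct (Hl d Hd) as (n1 & H1). destruct (Hx d Hd) as (n2 & H2). destruct (Hy d Hd) as (n3 & H3).
  set (n := (n1 + n2 + n3)%nat).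
  specialize (H1 (S n) ltac:(unfold n; lia)). specialize (H2 n ltac:(unfold n; lia)).
  specialize (H3 n ltac:(unfold n; lia)). rewrite Hrec in H1.
  pose proof (Hlip (u n) (v n) x y (Rlt_le _ _ (Hu n)) (Rlt_le _ _ (Hv n)) Hx0 Hy0) as Hbnd.
  fold t in Hbnd. set (r := transform N g (denom a b z (u n) (v n))) in *.
  assert (Hsum : c * (Cmod (u n - x) + Cmod (v n - y)) <= c * (d + d))
    by (apply Rmult_le_compat_l; lra).
  assert (He : e <= d + c * (d + d)).
  { unfold e. replace (l - t)%C with (- (r - l) + (r - t))%C by ring.
    eapply Rle_trans; [apply Cmod_triangle |]. rewrite Cmod_opp. lra. }
  assert (Ed : 2 * (d + c * (d + d)) = e) by (unfold d; field; lra). lra.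
Qed.

Definition step (N : nat) (a b : nat -> R) (z : C) (p : C * C) : C * C :=
  (transform N a (denom a b z (fst p) (snd p)),
   transform N b (denom a b z (fst p) (snd p))).

Lemma solution_exists (N : nat) (a b : nat -> R) (z : C) :
  (1 <= N)%nat -> positive_on N a -> positive_on N b -> upper_half_plane z ->
  exists p : C * C, is_solution N a b z p.
Proof.
  intros HN Ha Hb Hz. unfold upper_half_plane in Hz.
  pose proof (Rinv_0_lt_compat _ Hz) as Hie.
  pose proof (Ravg_pos N a HN Ha) as HA. pose proof (Ravg_pos N b HN Hb) as HB.
  (* W bounds the imaginary parts of all iterates: 1 is that of the starting
     point, the other two terms bound the values of the transforms. *)
  set (W := 1 + (/ Im z * Ravg N a + / Im z * Ravg N b)).
  assert (HW : / Im z * Ravg N a <= W /\ / Im z * Ravg N b <= W /\ 1 <= W)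
    by (unfold W; repeat split; nra).
  clearbody W. destruct HW as (HWa & HWb & HW).
  destruct (contraction_factor N a b (Im z) W Ha Hb Hz ltac:(lra)) as (q & Hq & Hfac).
  set (p := fun n => Nat.iter n (step N a b z) (Ci, Ci)).
  set (u := fun n => fst (p n)). set (v := fun n => snd (p n)).
  set (s := fun n => denom a b z (u n) (v n)).
  assert (Hstrip : forall n, 0 < Im (u n) -> 0 < Im (v n) -> in_strip N (Im z) (s n)).
  { intros n Hu Hv. apply denom_strip; try assumption; [apply Rle_refl | lra | lra]. }
  assert (Hbox : forall n, 0 < Im (u n) <= W /\ 0 < Im (v n) <= W).
  { induction n as [|n (IHu & IHv)]; [unfold u, v; simpl; lra |].
    pose proof (Hstrip n (proj1 IHu) (proj1 IHv)) as Hs.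
    pose proof (in_strip_pos _ _ _ Hz Hs) as Ps.
    change (u (S n)) with (transform N a (s n)). change (v (S n)) with (transform N b (s n)).
    pose proof (Im_transform_pos N a (s n) HN Ha Ps).
    pose proof (Im_transform_pos N b (s n) HN Hb Ps).
    pose proof (Im_transform_le N a (s n) (Im z) HN Ha Hz Hs).
    pose proof (Im_transform_le N b (s n) (Im z) HN Hb Hz Hs). lra. }
  assert (Pu : forall n, 0 < Im (u n)) by (intros n; apply Hbox).
  assert (Pv : forall n, 0 < Im (v n)) by (intros n; apply Hbox).
  assert (Ps : forall n, positive_on N (fun k => Im (s n k)))
    by (intros n; apply (in_strip_pos _ _ _ Hz), Hstrip; auto).
  assert (Hf : forall n k, (1 <= k <= N)%nat -> a k * Im (u n) + b k * Im (v n) <= q * Im (s n k)).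
  { intros n. destruct (Hbox n) as (Hu & Hv). apply Hfac; [apply Rle_refl | lra | lra]. }
  assert (Hstart : exists D : R, 0 <= D /\
    Cmod (u 1%nat - u O) <= D * weight (u 1%nat) (u O) /\
    Cmod (v 1%nat - v O) <= D * weight (v 1%nat) (v O)).
  { pose proof (weight_pos _ _ (Pu 1%nat) (Pu O)) as W1.
    pose proof (weight_pos _ _ (Pv 1%nat) (Pv O)) as W2.
    set (D1 := Cmod (u 1%nat - u O) / weight (u 1%nat) (u O)).
    set (D2 := Cmod (v 1%nat - v O) / weight (v 1%nat) (v O)).
    assert (HD1 : 0 <= D1) by (apply Rle_mult_inv_pos; [apply Cmod_ge_0 | exact W1]).
    assert (HD2 : 0 <= D2) by (apply Rle_mult_inv_pos; [apply Cmod_ge_0 | exact W2]).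
    exists (D1 + D2). split; [lra |]. rewrite !Rmult_plus_distr_r.
    replace (D1 * weight (u 1%nat) (u O)) with (Cmod (u 1%nat - u O)) by (unfold D1; field; lra).
    replace (D2 * weight (v 1%nat) (v O)) with (Cmod (v 1%nat - v O)) by (unfold D2; field; lra).
    split; nra. }
  destruct Hstart as (D & HD & HDu & HDv).
  assert (HDq : forall n, 0 <= D * q ^ n)
    by (intros n; apply Rmult_le_pos; [exact HD | apply pow_le; lra]).
  assert (Hcontr : forall n, Cmod (u (S n) - u n) <= D * q ^ n * weight (u (S n)) (u n) /\
                             Cmod (v (S n) - v n) <= D * q ^ n * weight (v (S n)) (v n)).
  { induction n as [|n (IHu & IHv)]; [simpl pow; rewrite Rmult_1_r; split; assumption |].
    replace (D * q ^ S n) with (D * q ^ n * q) by (simpl; ring).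
    pose proof (fun g Hg => transform_contracts N g a b z _ _ _ _ q (D * q ^ n) HN Hg Ha Hb
      (Pu (S n)) (Pv (S n)) (Pu n) (Pv n) (proj1 Hq) (HDq n) (Ps (S n)) (Ps n)
      (Hf (S n)) (Hf n) IHu IHv) as Hg.
    split; [exact (Hg a Ha) | exact (Hg b Hb)]. }
  assert (Hgeo : forall n w, 0 <= w <= W -> D * q ^ n * w <= D * W * q ^ n).
  { intros n w Hw. specialize (HDq n). nra. }
  destruct (geometric_steps_converge u (D * W) q Hq) as (x & Hx).
  { intros n. eapply Rle_trans; [apply Hcontr |]. apply Hgeo.
    split; [left; apply weight_pos; apply Pu | apply weight_le; try apply Hbox; lra]. }
  destruct (geometric_steps_converge v (D * W) q Hq) as (y & Hy).
  { intros n. eapply Rle_trans; [apply Hcontr |]. apply Hgeo.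
    split; [left; apply weight_pos; apply Pv | apply weight_le; try apply Hbox; lra]. }
  pose proof (transform_limit N a a b z x y x u v u HN Ha Ha Hb Hz Pu Pv Hx Hy Hx
                (fun n => eq_refl)) as Ex.
  pose proof (transform_limit N b a b z x y y u v v HN Hb Ha Hb Hz Pu Pv Hx Hy Hy
                (fun n => eq_refl)) as Ey.
  pose proof (in_strip_pos _ _ _ Hz (denom_strip N a b z x y (Im z) Ha Hb (Rle_refl _)
    (Im_limit_nonneg u x Pu Hx) (Im_limit_nonneg v y Pv Hy))) as Pt.
  exists (x, y). unfold is_solution, upper_half_plane; simpl fst; simpl snd.
  split; [rewrite Ex; apply Im_transform_pos; assumption |].
  split; [rewrite Ey; apply Im_transform_pos; assumption |].
  apply self_consistent_transform. split; assumption.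
Qed.

(** * Comparing two solutions *)

(** The determinant of [1 - K], where [K] has rows [K a a, K a b] and [K b a, K b b]. *)
Definition det (N : nat) (a b : nat -> R) (s t : nat -> C) : C :=
  ((1 - kernel N a a s t) * (1 - kernel N b b s t)
   - kernel N a b s t * kernel N b a s t)%C.

(** The Cramer numerator for [u], per unit change of [z]; exchanging [a] and [b]
    gives the one for [v]. *)
Definition num (N : nat) (a b : nat -> R) (s t : nat -> C) : C :=
  ((1 - kernel N b b s t) * kernel N a (fun _ => 1%R) s t
   + kernel N a b s t * kernel N b (fun _ => 1%R) s t)%C.

Lemma det_sym (N : nat) (a b : nat -> R) (s t : nat -> C) :
  det N b a s t = det N a b s t.
Proof. unfold det. ring. Qed.

Lemma Cmod_1_minus_ge (z : C) : 1 - Cmod z <= Cmod (1 - z).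
Proof.
  pose proof (Cmod_triangle (1 - z) z) as H.
  replace (1 - z + z)%C with (RtoC 1) in H by ring. rewrite Cmod_1 in H. lra.
Qed.

(** The row conditions give [(1 - q) * x + |B| * y <= |1 - A| * x] and
    [(1 - q) * y + |C| * x <= |1 - D| * y].  In their product the term
    [|B| * |C| * x * y] cancels against the off-diagonal part of the determinant. *)
Lemma Cmod_det_ge (A B C D : C) (x y q : R) :
  0 < x -> 0 < y -> q < 1 ->
  Cmod A * x + Cmod B * y <= q * x -> Cmod C * x + Cmod D * y <= q * y ->
  (1 - q) ^ 2 <= Cmod ((1 - A) * (1 - D) - B * C).
Proof.
  intros Hx Hy Hq HA HD.
  pose proof (Cmod_1_minus_ge A) as H1. pose proof (Cmod_1_minus_ge D) as H2.
  pose proof (Cmod_triangle ((1 - A) * (1 - D) - B * C) (B * C)) as H.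
  replace ((1 - A) * (1 - D) - B * C + B * C)%C with ((1 - A) * (1 - D))%C in H by ring.
  rewrite !Cmod_mult in H.
  pose proof (Cmod_ge_0 A); pose proof (Cmod_ge_0 B);
  pose proof (Cmod_ge_0 C); pose proof (Cmod_ge_0 D).
  assert (E1 : (1 - q) * x + Cmod B * y <= Cmod (1 - A) * x) by nra.
  assert (E2 : (1 - q) * y + Cmod C * x <= Cmod (1 - D) * y) by nra.
  assert (E : ((1 - q) * x + Cmod B * y) * ((1 - q) * y + Cmod C * x)
              <= Cmod (1 - A) * x * (Cmod (1 - D) * y)).
  { apply Rmult_le_compat; try assumption; apply Rplus_le_le_0_compat; apply Rmult_le_pos; lra. }
  assert (Hxy : 0 < x * y) by nra.
  assert (0 <= (1 - q) * (Cmod C * (x * x)) + (1 - q) * (Cmod B * (y * y))).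
  { apply Rplus_le_le_0_compat; (apply Rmult_le_pos; [lra | apply Rmult_le_pos; [lra | nra]]). }
  assert (Hprod : ((1 - q) ^ 2 + Cmod B * Cmod C) * (x * y)
                  <= Cmod (1 - A) * Cmod (1 - D) * (x * y)) by nra.
  apply Rmult_le_reg_r in Hprod; [lra | exact Hxy].
Qed.

Lemma cramer2 (A B C D b1 b2 dz x y : C) :
  (x = b1 * dz + A * x + B * y)%C -> (y = b2 * dz + C * x + D * y)%C ->
  (((1 - A) * (1 - D) - B * C) * x = dz * ((1 - D) * b1 + B * b2))%C.
Proof.
  intros Hx Hy.
  assert (Ex : (x - A * x = b1 * dz + B * y)%C) by (rewrite Hx at 1; ring).
  assert (Ey : (y - D * y = b2 * dz + C * x)%C) by (rewrite Hy at 1; ring).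
  transitivity ((1 - D) * (x - A * x) - B * (C * x))%C; [ring |]. rewrite Ex.
  transitivity ((1 - D) * (b1 * dz) + B * (y - D * y) - B * (C * x))%C; [ring |].
  rewrite Ey. ring.
Qed.

Lemma solution_strip (N : nat) (a b : nat -> R) (z : C) (p : C * C) (eta : R) :
  positive_on N a -> positive_on N b -> eta <= Im z -> is_solution N a b z p ->
  in_strip N eta (denom a b z (fst p) (snd p)).
Proof.
  intros Ha Hb Hz (Hu & Hv & _). apply denom_strip; try assumption; apply Rlt_le; assumption.
Qed.

(** The bound on the determinant depends on [eta] alone: for every solution with
    [eta <= Im z] the imaginary parts of [u] and [v] are at most [W], so one
    contraction factor serves all of them. *)
Lemma solution_pair (N : nat) (a b : nat -> R) (eta : R) :
  (1 <= N)%nat -> positive_on N a -> positive_on N b -> 0 < eta ->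
  exists c : R, 0 < c /\
    forall (z z' : C) (p p' : C * C),
      eta <= Im z -> eta <= Im z' ->
      is_solution N a b z p -> is_solution N a b z' p' ->
      let s := denom a b z (fst p) (snd p) in
      let t := denom a b z' (fst p') (snd p') in
      c <= Cmod (det N a b s t) /\
      (det N a b s t * (fst p - fst p') = (z - z') * num N a b s t)%C /\
      (det N a b s t * (snd p - snd p') = (z - z') * num N b a s t)%C.
Proof.
  intros HN Ha Hb Heta.
  pose proof (Ravg_pos N a HN Ha) as HA. pose proof (Ravg_pos N b HN Hb) as HB.
  pose proof (Rinv_0_lt_compat eta Heta) as Hie.
  set (W := / eta * Ravg N a + / eta * Ravg N b).
  assert (HW : / eta * Ravg N a <= W /\ / eta * Ravg N b <= W /\ 0 <= W)
    by (unfold W; repeat split; nra).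
  clearbody W. destruct HW as (HWa & HWb & HW).
  destruct (contraction_factor N a b eta W Ha Hb Heta HW) as (q & Hq & Hfac).
  exists ((1 - q) ^ 2). split; [apply pow_lt; lra |].
  intros z z' p p' Hz Hz' Hp Hp' s t.
  pose proof (solution_strip N a b z p eta Ha Hb Hz Hp) as Hs.
  pose proof (solution_strip N a b z' p' eta Ha Hb Hz' Hp') as Ht.
  fold s in Hs; fold t in Ht.
  assert (Hbound : forall (w : C) (r : C * C), eta <= Im w -> is_solution N a b w r ->
            0 <= Im (fst r) <= W /\ 0 <= Im (snd r) <= W).
  { intros w r Hw Hr. pose proof (solution_strip N a b w r eta Ha Hb Hw Hr) as Hst.
    destruct Hr as (Hu & Hv & Heq). unfold upper_half_plane in Hu, Hv.
    destruct (proj1 (self_consistent_transform _ _ _ _ _ _) Heq) as (Eu & Ev).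
    pose proof (Im_transform_le N a _ eta HN Ha Heta Hst) as Ca.
    pose proof (Im_transform_le N b _ eta HN Hb Heta Hst) as Cb.
    rewrite <- Eu in Ca. rewrite <- Ev in Cb.
    lra. }
  destruct (Hbound z p Hz Hp) as (Bu & Bv).
  destruct (Hbound z' p' Hz' Hp') as (Bu' & Bv').
  pose proof (Hfac z _ _ Hz Bu Bv) as Fs. pose proof (Hfac z' _ _ Hz' Bu' Bv') as Ft.
  fold s in Fs; fold t in Ft.
  pose proof (in_strip_pos _ _ _ Heta Hs) as Ps. pose proof (in_strip_pos _ _ _ Heta Ht) as Pt.
  destruct Hp as (Hu & Hv & Heq). destruct Hp' as (Hu' & Hv' & Heq').
  unfold upper_half_plane in Hu, Hv, Hu', Hv'.
  destruct (proj1 (self_consistent_transform _ _ _ _ _ _) Heq) as (Eu & Ev).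
  destruct (proj1 (self_consistent_transform _ _ _ _ _ _) Heq') as (Eu' & Ev').
  fold s in Eu, Ev; fold t in Eu', Ev'.
  assert (Hrow : forall g, positive_on N g -> _) by
    (intros g Hg; exact (kernel_row_bound N g a b s t _ _ _ _ q HN Hg Ha Hb
       Hu Hv Hu' Hv' (proj1 Hq) Ps Pt Fs Ft)).
  split.
  (* For solutions the transforms are u and v themselves, so the same weights
     stand on both sides of the row bounds. *)
  - pose proof (Hrow a Ha) as Ra. rewrite <- Eu, <- Eu' in Ra.
    pose proof (Hrow b Hb) as Rb. rewrite <- Ev, <- Ev' in Rb.
    refine (Cmod_det_ge _ _ _ _ _ _ q _ _ (proj2 Hq) Ra Rb);
      apply weight_pos; assumption.
  - assert (Hdiff : forall g, (transform N g s - transform N g t =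
        kernel N g (fun _ => 1%R) s t * (z - z') + kernel N g a s t * (fst p - fst p')
        + kernel N g b s t * (snd p - snd p'))%C).
    { intros g. exact (transform_denom_sub N g a b z z' _ _ _ _ Ps Pt). }
    pose proof (Hdiff a) as Da. rewrite <- Eu, <- Eu' in Da.
    pose proof (Hdiff b) as Db. rewrite <- Ev, <- Ev' in Db.
    split; [exact (cramer2 _ _ _ _ _ _ _ _ _ Da Db) |].
    rewrite <- det_sym. 
    apply (cramer2 _ _ _ _ _ _ _ _ (fst p - fst p')%C); [rewrite Db at 1 | rewrite Da at 1]; ring.
Qed.

Lemma num_bounded (N : nat) (a b : nat -> R) (eta : R) :
  (1 <= N)%nat -> positive_on N a -> positive_on N b -> 0 < eta ->
  exists L : R, 0 <= L /\ forall s t : nat -> C, in_strip N eta s -> in_strip N eta t ->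
    Cmod (num N a b s t) <= L.
Proof.
  intros HN Ha Hb Heta.
  assert (Hone : positive_on N (fun _ => 1)) by (intros k _; lra).
  destruct (kernel_bounded N b b eta HN Hb Hb Heta) as (L1 & HL1 & H1).
  destruct (kernel_bounded N a _ eta HN Ha Hone Heta) as (L2 & HL2 & H2).
  destruct (kernel_bounded N a b eta HN Ha Hb Heta) as (L3 & HL3 & H3).
  destruct (kernel_bounded N b _ eta HN Hb Hone Heta) as (L4 & HL4 & H4).
  exists ((1 + L1) * L2 + L3 * L4). split; [nra |]. intros s t Hs Ht.
  unfold num. eapply Rle_trans; [apply Cmod_triangle |]. rewrite !Cmod_mult.
  pose proof (Cmod_triangle 1 (- kernel N b b s t)) as H.
  rewrite Cmod_opp, Cmod_1 in H. specialize (H1 s t Hs Ht).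
  apply Rplus_le_compat; apply Rmult_le_compat; try apply Cmod_ge_0; auto.
  unfold Cminus. lra.
Qed.

Lemma solution_lipschitz (N : nat) (a b : nat -> R) (eta : R) :
  (1 <= N)%nat -> positive_on N a -> positive_on N b -> 0 < eta ->
  exists L : R, 0 <= L /\ forall (z z' : C) (p p' : C * C),
      eta <= Im z -> eta <= Im z' ->
      is_solution N a b z p -> is_solution N a b z' p' ->
      Cmod (fst p - fst p') <= L * Cmod (z - z') /\
      Cmod (snd p - snd p') <= L * Cmod (z - z').
Proof.
  intros HN Ha Hb Heta.
  destruct (solution_pair N a b eta HN Ha Hb Heta) as (c & Hc & Hpair).
  destruct (num_bounded N a b eta HN Ha Hb Heta) as (L1 & HL1 & H1).
  destruct (num_bounded N b a eta HN Hb Ha Heta) as (L2 & HL2 & H2).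
  exists ((L1 + L2) / c). split; [apply Rle_mult_inv_pos; lra |].
  intros z z' p p' Hz Hz' Hp Hp'.
  destruct (Hpair z z' p p' Hz Hz' Hp Hp') as (Hdet & Eu & Ev).
  pose proof (solution_strip N a b z p eta Ha Hb Hz Hp) as Hs.
  pose proof (solution_strip N a b z' p' eta Ha Hb Hz' Hp') as Ht.
  specialize (H1 _ _ Hs Ht). specialize (H2 _ _ Hs Ht).
  pose proof (Cmod_ge_0 (z - z')) as Hdz.
  assert (Hgen : forall x y : C, (det N a b (denom a b z (fst p) (snd p))
       (denom a b z' (fst p') (snd p')) * x = (z - z') * y)%C ->
       Cmod y <= L1 + L2 -> Cmod x <= (L1 + L2) / c * Cmod (z - z')).
  { intros x y E Hy. apply (f_equal Cmod) in E. rewrite !Cmod_mult in E.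
    pose proof (Cmod_ge_0 x) as Hx.
    apply Rmult_le_reg_l with c; [exact Hc |].
    replace (c * ((L1 + L2) / c * Cmod (z - z'))) with (Cmod (z - z') * (L1 + L2)) by (field; lra).
    apply Rle_trans with (Cmod (z - z') * Cmod y); [rewrite <- E |];
      [apply Rmult_le_compat_r | apply Rmult_le_compat_l]; assumption. }
  split; [apply (Hgen _ _ Eu) | apply (Hgen _ _ Ev)]; lra.
Qed.

Lemma solution_unique (N : nat) (a b : nat -> R) (z : C) (p p' : C * C) :
  (1 <= N)%nat -> positive_on N a -> positive_on N b -> upper_half_plane z ->
  is_solution N a b z p -> is_solution N a b z p' -> p = p'.
Proof.
  intros HN Ha Hb Hz Hp Hp'.
  destruct (solution_lipschitz N a b (Im z) HN Ha Hb Hz) as (L & HL & Hlip).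
  destruct (Hlip z z p p' (Rle_refl _) (Rle_refl _) Hp Hp') as (Hu & Hv).
  replace (z - z)%C with (RtoC 0) in Hu, Hv by ring.
  rewrite Cmod_0, Rmult_0_r in Hu, Hv.
  pose proof (Cmod_ge_0 (fst p - fst p')); pose proof (Cmod_ge_0 (snd p - snd p')).
  apply injective_projections; apply Ceq_minus, Cmod_eq_0; lra.
Qed.

(** * Holomorphy *)

Local Notation C_abs := (AbsRing_UniformSpace C_AbsRing).

(** Continuity for the modulus metric, the one used on the source side of complex
    derivatives; the product metric of [C_UniformSpace] is only equivalent to it. *)
Definition continuous_C (f : C -> C) (z : C) : Prop :=
  continuous (T := C_abs) (U := C_abs) f z.

Lemma continuous_C_eps (f : C -> C) (z : C) :
  (forall eps : R, 0 < eps -> exists d : R, 0 < d /\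
     forall w : C, Cmod (w - z) < d -> Cmod (f w - f z) < eps) ->
  continuous_C f z.
Proof.
  intros Hf. apply filterlim_locally. intros (eps & Heps).
  destruct (Hf eps Heps) as (d & Hd & Hfd).
  exists (mkposreal d Hd). intros w Hw. exact (Hfd w Hw).
Qed.

Lemma continuous_C_const (c z : C) : continuous_C (fun _ => c) z.
Proof. apply (continuous_const (U := C_abs) (V := C_abs)). Qed.

Lemma continuous_C_id (z : C) : continuous_C (fun w => w) z.
Proof. apply (continuous_id (U := C_abs)). Qed.

Lemma continuous_C_plus (f g : C -> C) (z : C) :
  continuous_C f z -> continuous_C g z -> continuous_C (fun w => (f w + g w)%C) z.
Proof. apply (continuous_plus (U := C_abs) (V := AbsRing_NormedModule C_AbsRing)). Qed.

Lemma continuous_C_mult (f g : C -> C) (z : C) :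
  continuous_C f z -> continuous_C g z -> continuous_C (fun w => (f w * g w)%C) z.
Proof. apply (continuous_mult (U := C_abs) (K := C_AbsRing)). Qed.

Lemma continuous_C_minus (f g : C -> C) (z : C) :
  continuous_C f z -> continuous_C g z -> continuous_C (fun w => (f w - g w)%C) z.
Proof. apply (continuous_minus (U := C_abs) (V := AbsRing_NormedModule C_AbsRing)). Qed.

Lemma continuous_C_inv (f : C -> C) (z : C) :
  continuous_C f z -> f z <> 0%C -> continuous_C (fun w => (/ f w)%C) z.
Proof.
  intros Hf Hfz.
  apply (continuous_comp (U := C_abs)
            (V := C_abs)
           (W := C_abs) f Cinv); [exact Hf |].
  apply (continuous_C_eps Cinv). generalize dependent (f z). intros x Hx eps Heps.
  apply Cmod_gt_0 in Hx. pose proof (Rmult_lt_0_compat _ _ Hx Hx) as Hxx.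
  exists (Rmin (Cmod x / 2) (eps * (Cmod x * Cmod x) / 2)). split.
  { apply Rmin_pos; [lra |]. apply Rdiv_lt_0_compat; nra. }
  intros w Hw.
  pose proof (Rlt_le_trans _ _ _ Hw (Rmin_l _ _)) as Hw1.
  pose proof (Rlt_le_trans _ _ _ Hw (Rmin_r _ _)) as Hw2.
  assert (Hw0 : Cmod x / 2 < Cmod w).
  { pose proof (Cmod_triangle w (- (w - x))) as H. rewrite Cmod_opp in H.
    replace (w + - (w - x))%C with x in H by ring. lra. }
  replace (/ w - / x)%C with (- ((w - x) / (w * x)))%C
    by (field; split; apply Cmod_gt_0; lra).
  rewrite Cmod_opp, Cmod_div, Cmod_mult by (apply Cmult_neq_0; apply Cmod_gt_0; lra).
  apply Rmult_lt_reg_r with (Cmod w * Cmod x); [nra |].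
  unfold Rdiv. rewrite Rmult_assoc, Rinv_l by nra.
  assert (eps * (Cmod x * Cmod x) / 2 < eps * (Cmod w * Cmod x)).
  { replace (eps * (Cmod x * Cmod x) / 2) with (eps * (Cmod x / 2 * Cmod x)) by field.
    apply Rmult_lt_compat_l; [exact Heps |]. apply Rmult_lt_compat_r; assumption. }
  lra.
Qed.

Lemma continuous_C_Cavg (N : nat) (f : nat -> C -> C) (z : C) :
  (forall k : nat, (1 <= k <= N)%nat -> continuous_C (f k) z) ->
  continuous_C (fun w => Cavg N (fun k => f k w)) z.
Proof.
  intros Hf. apply continuous_C_mult; [apply continuous_C_const |].
  induction N as [|N IH].
  - apply (continuous_ext (T := C_abs)
             (U := C_abs) (fun _ => RtoC 0)).
    + intros w. rewrite sum_n_m_zero by lia. reflexivity.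
    + apply continuous_C_const.
  - apply (continuous_ext (T := C_abs)
             (U := C_abs)
             (fun w => sum_n_m (G := C_AbelianGroup) (fun k => f k w) 1 N + f (S N) w)%C).
    + intros w. rewrite sum_n_Sm by lia. reflexivity.
    + apply continuous_C_plus; [apply IH; intros k Hk |]; apply Hf; lia.
Qed.

(** Caratheodory's form of differentiability: a factor [phi] continuous at [z] stands
    for the difference quotient, and its value [phi z] is the derivative. *)
Lemma ex_derive_caratheodory (f phi : C -> C) (z : C) (r : R) :
  0 < r -> continuous_C phi z ->
  (forall w : C, Cmod (w - z) < r -> (f w - f z = (w - z) * phi w)%C) ->
  ex_derive (K := C_AbsRing) (V := C_NormedModule) f z.
Proof.
  intros Hr Hphi Hf. exists (phi z). split.
  - apply (is_linear_scal_l (K := C_AbsRing) (V := C_NormedModule)).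
  - intros x Hx.
    apply (is_filter_lim_locally_unique (K := C_AbsRing)
             (V := AbsRing_NormedModule C_AbsRing)) in Hx. subst x.
    intros eps.
    destruct (proj1 (filterlim_locally _ _) Hphi eps) as (d & Hd).
    exists (mkposreal _ (Rmin_pos d r (cond_pos d) Hr)). intros w Hw.
    change (Cmod (w - z) < Rmin d r) in Hw.
    pose proof (Rlt_le_trans _ _ _ Hw (Rmin_l _ _)) as Hw1.
    pose proof (Rlt_le_trans _ _ _ Hw (Rmin_r _ _)) as Hw2.
    specialize (Hd w Hw1). change (Cmod (phi w - phi z) < eps) in Hd.
    change (Cmod (f w - f z - (w - z) * phi z) <= eps * Cmod (w - z)).
    rewrite (Hf w Hw2).
    replace ((w - z) * phi w - (w - z) * phi z)%C with ((phi w - phi z) * (w - z))%C by ring.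
    rewrite Cmod_mult. apply Rmult_le_compat_r; [apply Cmod_ge_0 | lra].
Qed.

Lemma continuous_C_kernel (N : nat) (g h : nat -> R) (s : C -> nat -> C) (t : nat -> C) (z : C) :
  (forall k : nat, (1 <= k <= N)%nat ->
     continuous_C (fun w => s w k) z /\ s z k <> 0%C /\ t k <> 0%C) ->
  continuous_C (fun w => kernel N g h (s w) t) z.
Proof.
  intros Hs. apply continuous_C_Cavg. intros k Hk. destruct (Hs k Hk) as (Hc & Hs0 & Ht0).
  apply continuous_C_mult; [apply continuous_C_const |].
  apply continuous_C_inv; [| apply Cmult_neq_0; assumption].
  apply continuous_C_mult; [exact Hc | apply continuous_C_const].
Qed.

(** [solution_pair] exhibits the difference quotients of [u] and [v] as quotients of
    [num] by [det], which are continuous functions of the second point once [u] and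
    [v] are known to be; that continuity is the Lipschitz bound on the half plane
    [Im w >= Im z / 2]. *)
Lemma holomorphic_solution (N : nat) (a b : nat -> R) (u v : C -> C) :
  (1 <= N)%nat -> positive_on N a -> positive_on N b ->
  (forall z : C, upper_half_plane z -> is_solution N a b z (u z, v z)) ->
  holomorphic_on upper_half_plane u /\ holomorphic_on upper_half_plane v.
Proof.
  intros HN Ha Hb Hsol.
  assert (H : forall z : C, upper_half_plane z ->
    ex_derive (K := C_AbsRing) (V := C_NormedModule) u z /\
    ex_derive (K := C_AbsRing) (V := C_NormedModule) v z);
    [| split; intros z Hz; apply H, Hz].
  intros z Hz. unfold upper_half_plane in Hz.
  assert (Heta : 0 < Im z / 2) by lra. set (eta := Im z / 2) in *.
  assert (Hnear : forall w, Cmod (w - z) < eta -> eta <= Im w).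
  { intros w Hw. pose proof (im_le_Cmod (- (w - z))) as Him. rewrite Cmod_opp in Him.
    unfold Cminus in Him, Hw. rewrite im_opp, im_plus, im_opp in Him. unfold eta in *. lra. }
  assert (Hez : eta <= Im z) by (unfold eta; lra).
  destruct (solution_pair N a b eta HN Ha Hb Heta) as (c & Hc & Hpair).
  destruct (solution_lipschitz N a b eta HN Ha Hb Heta) as (L & HL & Hlip).
  assert (Hsw : forall w, Cmod (w - z) < eta -> is_solution N a b w (u w, v w)).
  { intros w Hw. apply Hsol. unfold upper_half_plane. specialize (Hnear w Hw). lra. }
  assert (Hzz : Cmod (z - z) < eta).
  { replace (z - z)%C with (RtoC 0) by ring. rewrite Cmod_0. exact Heta. }
  assert (Hcont : forall f : C -> C, (forall w, Cmod (w - z) < eta ->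
            Cmod (f w - f z) <= L * Cmod (w - z)) -> continuous_C f z).
  { intros f Hf. apply continuous_C_eps. intros eps Heps.
    (* L + 1 because L may vanish. *)
    assert (He : 0 < eps / (L + 1)) by (apply Rdiv_lt_0_compat; lra).
    exists (Rmin eta (eps / (L + 1))). split; [apply Rmin_pos; assumption |].
    intros w Hw.
    pose proof (Rlt_le_trans _ _ _ Hw (Rmin_l _ _)) as Hw1.
    pose proof (Rlt_le_trans _ _ _ Hw (Rmin_r _ _)) as Hw2.
    apply Rle_lt_trans with ((L + 1) * Cmod (w - z)).
    - eapply Rle_trans; [apply Hf, Hw1 |].
      apply Rmult_le_compat_r; [apply Cmod_ge_0 | lra].
    - apply Rmult_lt_reg_r with (/ (L + 1)); [apply Rinv_0_lt_compat; lra |].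
      rewrite (Rmult_comm (L + 1)), Rmult_assoc, Rinv_r by lra. lra. }
  assert (Hu : continuous_C u z).
  { apply Hcont. intros w Hw. exact (proj1 (Hlip w z _ _ (Hnear w Hw) Hez (Hsw w Hw) (Hsw z Hzz))). }
  assert (Hv : continuous_C v z).
  { apply Hcont. intros w Hw. exact (proj2 (Hlip w z _ _ (Hnear w Hw) Hez (Hsw w Hw) (Hsw z Hzz))). }
  set (s := fun w => denom a b w (u w) (v w)).
  pose proof (solution_strip N a b z _ eta Ha Hb Hez (Hsw z Hzz)) as Hsz.
  change (in_strip N eta (s z)) in Hsz.
  assert (Hker : forall g h, continuous_C (fun w => kernel N g h (s w) (s z)) z).
  { intros g h. apply continuous_C_kernel. intros k Hk.
    assert (Hk0 : s z k <> 0%C) by (apply Im_pos_neq_0; specialize (Hsz k Hk); lra).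
    split; [| split; exact Hk0].
    apply (continuous_C_plus (fun w => w + RtoC (a k) * u w)%C (fun w => RtoC (b k) * v w)%C);
      [apply (continuous_C_plus (fun w => w) (fun w => RtoC (a k) * u w)%C);
         [apply continuous_C_id |] |];
      (apply continuous_C_mult; [apply continuous_C_const | assumption]). }
  assert (Hone_minus : forall g h, continuous_C (fun w => 1 - kernel N g h (s w) (s z))%C z).
  { intros g h. apply continuous_C_minus; [apply continuous_C_const | apply Hker]. }
  assert (Hdet : continuous_C (fun w => det N a b (s w) (s z)) z).
  { unfold det. apply continuous_C_minus; apply continuous_C_mult;
      [apply Hone_minus | apply Hone_minus | apply Hker | apply Hker]. }
  assert (Hnum : forall g h, continuous_C (fun w => num N g h (s w) (s z)) z).
  { intros g h. unfold num. apply continuous_C_plus; apply continuous_C_mult;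
      [apply Hone_minus | apply Hker | apply Hker | apply Hker]. }
  assert (Hdet0 : forall w, Cmod (w - z) < eta -> det N a b (s w) (s z) <> 0%C).
  { intros w Hw. apply Cmod_gt_0.
    destruct (Hpair w z _ _ (Hnear w Hw) Hez (Hsw w Hw) (Hsw z Hzz)) as (Hd & _).
    cbv zeta in Hd. eapply Rlt_le_trans; [exact Hc | exact Hd]. }
  assert (Hderiv : forall (f : C -> C) (g h : nat -> R),
    (forall w, Cmod (w - z) < eta ->
       (det N a b (s w) (s z) * (f w - f z) = (w - z) * num N g h (s w) (s z))%C) ->
    ex_derive (K := C_AbsRing) (V := C_NormedModule) f z).
  { intros f g h Hf.
    apply (ex_derive_caratheodory f
             (fun w => num N g h (s w) (s z) * / det N a b (s w) (s z))%C z eta Heta).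
    - apply continuous_C_mult; [apply Hnum |].
      apply continuous_C_inv; [exact Hdet | apply Hdet0, Hzz].
    - intros w Hw. pose proof (Hdet0 w Hw) as Hd0. specialize (Hf w Hw).
      rewrite Cmult_assoc, <- Hf. field. exact Hd0. }
  split.
  - apply (Hderiv u a b). intros w Hw.
    exact (proj1 (proj2 (Hpair w z _ _ (Hnear w Hw) Hez (Hsw w Hw) (Hsw z Hzz)))).
  - apply (Hderiv v b a). intros w Hw.
    exact (proj2 (proj2 (Hpair w z _ _ (Hnear w Hw) Hez (Hsw w Hw) (Hsw z Hzz)))).
Qed.

(** * Existence, uniqueness and analyticity of the solution *)

Theorem theorem5p1 (M : R) (HM : (0 < M)%R)
    (N : nat) (HN : (1 <= N)%nat) (alpha beta : nat -> R)
    (Halpha : forall k : nat, (1 <= k <= N)%nat -> (1 <= alpha k)%R)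
    (Hbeta : forall k : nat, (1 <= k <= N)%nat -> (1 <= beta k)%R)
    (Hbound : (1 / INR N * sum_n_m (fun k => alpha k ^ 2 + beta k ^ 2) 1 N <= M)%R) :
  (forall z : C, upper_half_plane z ->
     exists! p : C * C, is_solution N alpha beta z p) /\
  (exists u v : C -> C,
     (forall z : C, upper_half_plane z -> is_solution N alpha beta z (u z, v z)) /\
     holomorphic_on upper_half_plane u /\
     holomorphic_on upper_half_plane v).
Proof.
  assert (Ha : positive_on N alpha) by (intros k Hk; specialize (Halpha k Hk); lra).
  assert (Hb : positive_on N beta) by (intros k Hk; specialize (Hbeta k Hk); lra).
  split.
  - intros z Hz. destruct (solution_exists N alpha beta z HN Ha Hb Hz) as (p & Hp).
    exists p. split; [exact Hp |].
    intros p' Hp'. exact (solution_unique N alpha beta z p p' HN Ha Hb Hz Hp Hp').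
  - set (p := fun z => epsilon (inhabits (RtoC 0, RtoC 0)) (is_solution N alpha beta z)).
    assert (Hp : forall z, upper_half_plane z ->
              is_solution N alpha beta z (fst (p z), snd (p z))).
    { intros z Hz. rewrite <- surjective_pairing.
      apply epsilon_spec, solution_exists; assumption. }
    exists (fun z => fst (p z)), (fun z => snd (p z)).
    split; [exact Hp |].
    exact (holomorphic_solution N alpha beta _ _ HN Ha Hb Hp).
Qed.
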